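(* Let $A\in\mathbb{R}^{m\times n}$ and $0\neq b\in\mathbb{R}^m$, and consider the first $k\ge 1$ steps of the Golub-Kahan iterative bidiagonalization of $A$ started with $b$, where it is assumed that the process does not terminate before iteration $k+1$, i.e. $\alpha_l>0$ and $\beta_{l+1}>0$ for $l=1,\dots,k$, and that moreover $\alpha_{k+1}>0$ (so that $w_{k+1}$ is defined). Let $r_k^{\text{LSMR}}=b-Ax_k^{\text{LSMR}}$, where $x_k^{\text{LSMR}}=W_k y_k^{\text{LSMR}}$ and $$y_k^{\text{LSMR}}=\operatorname{argmin}_{y\in\mathbb{R}^k}\|\beta_1\alpha_1e_1-L_{k+1}^TL_{k+}y\|.$$ Then $$r_k^{\text{LSMR}}=\frac{1}{\sum_{l=0}^k\psi_l(0)^2}\sum_{l=0}^k\left(\varphi_l(0)\sum_{j=l}^k\alpha_{j+1}^{-1}\varphi_j(0)^{-1}\psi_j(0)\right)s_{l+1}.$$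
   Context: Exact arithmetic is assumed. $\|\cdot\|$ is the Euclidean norm and $e_j$ is the $j$-th column of an identity matrix of appropriate size. Golub-Kahan iterative bidiagonalization: put $w_0=0$, $\beta_1=\|b\|$, $s_1=b/\beta_1$, and for $j=1,2,\dots$ $$\alpha_j w_j = A^Ts_j-\beta_j w_{j-1},\quad \|w_j\|=1,\qquad \beta_{j+1}s_{j+1}=Aw_j-\alpha_j s_j,\quad \|s_{j+1}\|=1,$$ with $\alpha_j,\beta_{j+1}\ge 0$; the process stops when $\alpha_j=0$ or $\beta_{j+1}=0$, or $j=\min(m,n)$. The vectors $s_1,s_2,\dots$ are orthonormal, as are $w_1,w_2,\dots$. $W_k=[w_1,\dots,w_k]\in\mathbb{R}^{n\times k}$. For each $i$, $L_i\in\mathbb{R}^{i\times i}$ is the lower bidiagonal matrix with diagonal entries $\alpha_1,\dots,\alpha_i$ and subdiagonal entries $\beta_2,\dots,\beta_i$ (so $(L_i)_{j,j}=\alpha_j$, $(L_i)_{j+1,j}=\beta_{j+1}$), and $L_{k+}\in\mathbb{R}^{(k+1)\times k}$ is $L_k$ with the additional last row $\beta_{k+1}e_k^T$. For $l\ge 0$, $\varphi_l$ and $\psi_l$ denote the (Lanczos) polynomials of degree at most $l$ such that $s_{l+1}=\varphi_l(AA^T)b$ and $w_{l+1}=\psi_l(A^TA)A^Tb$. Their constant terms are given by $$\varphi_l(0)=(-1)^l\frac{1}{\beta_{l+1}}\prod_{j=1}^l\frac{\alpha_j}{\beta_j}\quad(\text{so }\varphi_0(0)=1/\beta_1),$$ $$\psi_0(0)=\frac{1}{\alpha_1\beta_1},\qquad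 \psi_l(0)=\frac{1}{\alpha_{l+1}}\bigl(\varphi_l(0)-\beta_{l+1}\psi_{l-1}(0)\bigr),\quad l=1,2,\dots.$$ *)

(* Defs.v *)
From mathcomp Require Import all_boot all_order all_algebra.
From mathcomp Require Import reals.

Set Implicit Arguments.
Unset Strict Implicit.
Unset Printing Implicit Defensive.

Import Order.TTheory GRing.Theory Num.Theory.
Local Open Scope ring_scope.

Section GolubKahan.
Variable R : realType.

Definition enorm n (v : 'cV[R]_n) : R := Num.sqrt (\sum_(i < n) v i 0 ^+ 2).

(* One-based, as for all the sequences below: [unit_col n 1] is the first
   column of the identity. *)
Definition unit_col n (j : nat) : 'cV[R]_n := \col_(i < n) (i.+1 == j)%:R.

Definition is_argmin (T : Type) (f : T -> R) (y : T) : Prop :=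
  forall z : T, f y <= f z.

Variables m n : nat.
Variables (A : 'M[R]_(m, n)) (b : 'cV[R]_m).

(* The state after j steps holds alpha_j, w_j, beta_(j+1), s_(j+1); the
   component alpha_0 is a dummy. *)
Record gk_state : Type := GKState {
  st_alpha : R;
  st_w : 'cV[R]_n;
  st_beta : R;
  st_s : 'cV[R]_m }.

Definition gk_init : gk_state :=
  let beta := enorm b in GKState 0 0 beta (beta^-1 *: b).

Definition gk_step (st : gk_state) : gk_state :=
  let u := A^T *m st_s st - st_beta st *: st_w st in
  let alpha := enorm u in
  let w := alpha^-1 *: u in
  let v := A *m w - alpha *: st_s st in
  let beta := enorm v in
  GKState alpha w beta (beta^-1 *: v).

(* The recursion carries no stopping test: step j is meaningful as long as the
   norms it divides by are positive. *)
Definition golub_kahan (j : nat) : gk_state := iter j gk_step gk_init.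

(* [gk_beta 0] and [gk_s 0] are dummies. *)
Definition gk_alpha (j : nat) : R := st_alpha (golub_kahan j).
Definition gk_w (j : nat) : 'cV[R]_n := st_w (golub_kahan j).
Definition gk_beta (j : nat) : R := st_beta (golub_kahan j.-1).
Definition gk_s (j : nat) : 'cV[R]_m := st_s (golub_kahan j.-1).

Definition gk_W (k : nat) : 'M[R]_(n, k) :=
  \matrix_(i < n, j < k) gk_w j.+1 i 0.

(* Row p and column q (from 0) are row p+1 and column q+1 in one-based
   indexing, whence the shifted indices of alpha and beta. *)
Definition gk_L (i : nat) : 'M[R]_i :=
  \matrix_(p < i, q < i)
    if p == q then gk_alpha q.+1
    else if p == q.+1 :> nat then gk_beta p.+1 else 0.

Definition gk_Lplus (k : nat) : 'M[R]_(k + 1, k) :=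
  col_mx (gk_L k) (gk_beta k.+1 *: (unit_col k k)^T).

Definition lsmr_objective (k : nat) (y : 'cV[R]_k) : R :=
  enorm ((gk_beta 1 * gk_alpha 1) *: unit_col (k + 1) 1
         - (gk_L (k + 1))^T *m gk_Lplus k *m y).

Definition lsmr_residual (k : nat) (y : 'cV[R]_k) : 'cV[R]_m :=
  b - A *m (gk_W k *m y).

End GolubKahan.

(* Main.v *)
Require Import Defs.
From mathcomp Require Import all_boot all_order all_algebra.
From mathcomp Require Import reals ring zify.

(** Why the formula holds.  Let S = [s_1, ..., s_(k+1)], let L be the square
    bidiagonal matrix L_(k+1), L+ its first k columns, let phi and psi stand for
    the vectors of the constant terms of the Lanczos polynomials, and let
    c = 1 / |psi|^2.

    The recurrence of the bidiagonalization says A W_k = S L+ and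
    b = beta_1 S e_1, so the residual is S (beta_1 e_1 - L+ y), and LSMR
    minimizes the norm of L^T (beta_1 e_1 - L+ y).  The vectors s_j, and likewise
    the w_j, are orthonormal ([gk_orthonormal]) and satisfy three-term
    recurrences, so no nonzero polynomial of degree at most k annihilates the
    starting vector ([krylov_annihilator_eq0]).  Hence the vector recurrences
    lift to polynomial identities ([lanczos_phiS], [lanczos_psiS]), and at 0
    these read L psi = phi and L+^T phi = 0.

    Therefore psi is orthogonal to the range of L^T L+.  Let T be the
    solution of L^T T = psi that back substitution gives; its entries are,
    up to the factor c, the coefficients of the s_(l+1) in the formula.  The vector
    beta_1 e_1 - c T is orthogonal to phi, the constant c being chosen for
    that, and forward substitution then writes it as L+ x ([Lp_mul_x]).  At
    this x the vector to be minimized is c psi, and at any y it is c psi plus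
    something in the range of L^T L+; by Pythagoras every minimizer produces
    exactly c psi, and as L^T is invertible, beta_1 e_1 - L+ y = c T
    ([argmin_reduced_residual]).  Applying S to c T gives the claim. *)

Import Order.TTheory GRing.Theory Num.Theory.
Local Open Scope ring_scope.
Set Implicit Arguments.
Unset Strict Implicit.
Unset Printing Implicit Defensive.

(** * Inner products and orthonormal families *)

Section Dot.
Variable R : realType.

Definition dot n (u v : 'cV[R]_n) : R := \sum_(i < n) u i 0 * v i 0.

Lemma dotC n (u v : 'cV[R]_n) : dot u v = dot v u.
Proof. by apply: eq_bigr => i _; rewrite mulrC. Qed.

Lemma dotDr n (u v w : 'cV[R]_n) : dot u (v + w) = dot u v + dot u w.
Proof. by rewrite -big_split; apply: eq_bigr => i _; rewrite !mxE mulrDr. Qed.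

Lemma dotZr n a (u v : 'cV[R]_n) : dot u (a *: v) = a * dot u v.
Proof. by rewrite mulr_sumr; apply: eq_bigr => i _; rewrite !mxE mulrCA. Qed.

(** Expanding the combination in one step keeps the vectors folded: a
    normalized vector is itself a scaling by definition, so repeated rewriting
    with [dotZr] would open it. *)
Lemma dotDZr n x y (u v w : 'cV[R]_n) :
  dot u (x *: v + y *: w) = x * dot u v + y * dot u w.
Proof. by rewrite dotDr !dotZr. Qed.

Lemma dotDl n (u v w : 'cV[R]_n) : dot (u + v) w = dot u w + dot v w.
Proof. by rewrite ![dot _ w]dotC dotDr. Qed.

Lemma dotZl n a (u v : 'cV[R]_n) : dot (a *: u) v = a * dot u v.
Proof. by rewrite ![dot _ v]dotC dotZr. Qed.

Lemma dot0r n (u : 'cV[R]_n) : dot u 0 = 0.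
Proof. by rewrite -[0](scale0r 0) dotZr mul0r. Qed.

Lemma dot_sumr n (u : 'cV[R]_n) N (F : 'I_N -> 'cV[R]_n) :
  dot u (\sum_i F i) = \sum_i dot u (F i).
Proof. by apply: (big_morph (dot u)); [exact: dotDr | exact: dot0r]. Qed.

Lemma dotE n (u v : 'cV[R]_n) : dot u v = (u^T *m v) 0 0.
Proof. by rewrite mxE; apply: eq_bigr => i _; rewrite mxE. Qed.

Lemma dot_mulmx m n (A : 'M[R]_(m, n)) u v : dot u (A *m v) = dot (A^T *m u) v.
Proof. by rewrite !dotE trmx_mul trmxK mulmxA. Qed.

Lemma dot_ge0 n (u : 'cV[R]_n) : 0 <= dot u u.
Proof. by apply: sumr_ge0 => i _; rewrite -expr2 sqr_ge0. Qed.

Lemma dot_eq0 n (u : 'cV[R]_n) : dot u u = 0 -> u = 0.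
Proof.
move=> u0; apply/colP => i; rewrite mxE; apply/eqP; rewrite -sqrf_eq0 expr2.
have /psumr_eq0P u0' : forall i, true -> 0 <= u i 0 * u i 0.
  by move=> j _; rewrite -expr2 sqr_ge0.
by rewrite u0'.
Qed.

Lemma enormE n (u : 'cV[R]_n) : enorm u = Num.sqrt (dot u u).
Proof. by congr Num.sqrt; apply: eq_bigr => i _; rewrite expr2. Qed.

Lemma enorm_sqr n (u : 'cV[R]_n) : enorm u ^+ 2 = dot u u.
Proof. by rewrite enormE sqr_sqrtr ?dot_ge0. Qed.

Lemma enorm_eq0 n (u : 'cV[R]_n) : enorm u = 0 -> u = 0.
Proof. by move=> u0; apply: dot_eq0; rewrite -enorm_sqr u0 expr0n. Qed.

Lemma normalizeK n (u : 'cV[R]_n) : enorm u *: ((enorm u)^-1 *: u) = u.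
Proof.
have [/enorm_eq0 ->|u0] := eqVneq (enorm u) 0; first by rewrite !scaler0.
by rewrite scalerA divff ?scale1r.
Qed.

Lemma dot_normalize n (u : 'cV[R]_n) :
  0 < enorm u -> dot ((enorm u)^-1 *: u) ((enorm u)^-1 *: u) = 1.
Proof.
by move=> u0; rewrite dotZl dotZr -enorm_sqr; field; rewrite gt_eqF.
Qed.

Definition orthonormal_upto n (v : nat -> 'cV[R]_n) (k : nat) :=
  forall i j, (i <= k)%N -> (j <= k)%N -> dot (v i) (v j) = (i == j)%:R.

Lemma orthonormal_uptoS n (v : nat -> 'cV[R]_n) k :
    orthonormal_upto v k -> dot (v k.+1) (v k.+1) = 1 ->
    (forall i, (i <= k)%N -> dot (v k.+1) (v i) = 0) ->
  orthonormal_upto v k.+1.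
Proof.
move=> vk v1 v0 i j; rewrite leq_eqVlt => /predU1P[->|ik];
  rewrite leq_eqVlt => /predU1P[->|jk].
- by rewrite v1 eqxx.
- by rewrite v0 // gtn_eqF.
- by rewrite dotC v0 // ltn_eqF.
- exact: vk.
Qed.

(** * Krylov spaces of an operator tridiagonal in an orthonormal family *)

(** Each application of [B] raises the largest index that occurs by at most
    one, so [B ^+ i *m v j] stays in the span of [v 0, ..., v (i + j)]
    as long as [i + j <= k]. *)
Lemma tridiag_krylov_orth n (B : 'M[R]_n.+1) (v : nat -> 'cV[R]_n.+1) k :
    orthonormal_upto v k ->
    (forall j, (j < k)%N -> exists x y z,
       B *m v j = x *: v j.-1 + y *: v j + z *: v j.+1) ->
  forall i j d, (d <= k)%N -> (i + j < d)%N -> dot (v d) (B ^+ i *m v j) = 0.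
Proof.
move=> vk Bv; elim=> [|i IHi] j d dk ijd.
  by rewrite expr0 mul1mx vk //; [rewrite gtn_eqF | lia].
have [|x [y [z Bvj]]] := Bv j; first by lia.
rewrite exprSr -mulmxA Bvj !mulmxDr -!scalemxAr !dotDr !dotZr.
by rewrite !IHi //; [ring | lia..].
Qed.

(** If [p] had degree [d <= k] and annihilated [c], reducing [phi d] modulo
    [p] would express [v d] by the powers [B ^+ i *m c] with [i < d], all of
    which are orthogonal to [v d]; but [v d] is a unit vector. *)
Lemma krylov_annihilator_eq0 n (B : 'M[R]_n.+1) (v : nat -> 'cV[R]_n.+1) k
    (c : 'cV[R]_n.+1) (a : R) (phi : nat -> {poly R}) :
    orthonormal_upto v k ->
    (forall j, (j < k)%N -> exists x y z,
       B *m v j = x *: v j.-1 + y *: v j + z *: v j.+1) ->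
    c = a *: v 0 ->
    (forall l, (l <= k)%N -> v l = horner_mx B (phi l) *m c) ->
  forall p : {poly R}, (size p <= k.+1)%N -> horner_mx B p *m c = 0 -> p = 0.
Proof.
move=> vk Bv cE phiE p sp pc; apply/eqP; apply/negP => /negP p0.
pose d := (size p).-1.
have sd : size p = d.+1 by rewrite /d prednK // lt0n size_poly_eq0.
have dk : (d <= k)%N by lia.
have /eqP := vk d d dk dk; rewrite eqxx => /eqP/esym; apply/eqP.
pose r := phi d %% p.
have sr : (size r <= d)%N by rewrite -ltnS -sd ltn_modpN0.
have -> : dot (v d) (v d) = dot (v d) (horner_mx B r *m c).
  rewrite {2}phiE // {1}(divp_eq (phi d) p) rmorphD rmorphM.
  by rewrite mulmxDl -mulmxA pc mulmx0 add0r.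
rewrite -[r]coefK poly_def raddf_sum mulmx_suml dot_sumr big1 ?oner_eq0 //= => i _.
rewrite horner_mxZ rmorphXn /= horner_mx_X -scalemxAl cE -scalemxAr !dotZr.
by rewrite (tridiag_krylov_orth vk Bv) ?mulr0 // addn0 (leq_trans _ sr).
Qed.

Lemma mulmxDZr m n (A : 'M[R]_(m, n)) x y (u v : 'cV[R]_n) :
  A *m (x *: u + y *: v) = x *: (A *m u) + y *: (A *m v).
Proof. by rewrite mulmxDr -!scalemxAr. Qed.

Lemma horner_mx_mulC m n (A : 'M[R]_(m.+1, n.+1)) (B : 'M[R]_(n.+1, m.+1)) p :
  A *m horner_mx (B *m A) p = horner_mx (A *m B) p *m A.
Proof.
elim/poly_ind: p => [|p c IHp]; first by rewrite !rmorph0 mulmx0 mul0mx.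
rewrite !rmorphD !rmorphM /= !horner_mx_X !horner_mx_C mulmxDr mulmxDl.
rewrite [A *m (_ * _)]mulmxA IHp -!mulmxA; congr (_ + _).
by rewrite mul_mx_scalar mul_scalar_mx.
Qed.

End Dot.

(** * Golub-Kahan vectors *)

Section GK.
Variables (R : realType) (m n : nat) (A : 'M[R]_(m, n)) (b : 'cV[R]_m).
Notation al := (gk_alpha A b).
Notation be := (gk_beta A b).
Notation s := (gk_s A b).
Notation w := (gk_w A b).

Lemma gk_beta1 : be 1 *: s 1 = b.
Proof. exact: normalizeK. Qed.

Lemma gk_w_rec j : al j.+1 *: w j.+1 = A^T *m s j.+1 - be j.+1 *: w j.
Proof. exact: normalizeK. Qed.

Lemma gk_s_rec j : be j.+2 *: s j.+2 = A *m w j.+1 - al j.+1 *: s j.+1.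
Proof. exact: normalizeK. Qed.

Lemma gk_w0 : w 0 = 0. Proof. by []. Qed.

Lemma mul_gk_w j : A *m w j.+1 = al j.+1 *: s j.+1 + be j.+2 *: s j.+2.
Proof. by rewrite gk_s_rec addrC subrK. Qed.

Lemma mul_gk_s j : A^T *m s j.+1 = al j.+1 *: w j.+1 + be j.+1 *: w j.
Proof. by rewrite gk_w_rec subrK. Qed.

Lemma dot_gk_s j : 0 < be j.+1 -> dot (s j.+1) (s j.+1) = 1.
Proof. by case: j => [|j] h; apply: dot_normalize. Qed.

Lemma dot_gk_w j : 0 < al j.+1 -> dot (w j.+1) (w j.+1) = 1.
Proof. exact: dot_normalize. Qed.

(** Orthogonality spreads alternately: [A] maps the [w j] to [s j] and
    [s j.+1], while [A^T] maps the [s j] to [w j] and [w j.-1], so each inner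
    product of a new vector with the old ones reduces to inner products already
    known. *)
Lemma gk_orthonormal k :
    (forall l, (l <= k)%N -> 0 < al l.+1 /\ 0 < be l.+1) ->
  orthonormal_upto (fun j => s j.+1) k /\ orthonormal_upto (fun j => w j.+1) k.
Proof.
elim: k => [|k IHk] pos.
  have [a0 b0] := pos 0 isT.
  by split=> -[|//] [|//] _ _; rewrite (dot_gk_s, dot_gk_w).
have [|os ow] := IHk; first by move=> l lk; apply: pos; lia.
have [ak bk] := pos k.+1 (leqnn _).
have os' : orthonormal_upto (fun j => s j.+1) k.+1.
  apply: orthonormal_uptoS => //= [|i ik]; first exact: dot_gk_s.
  apply: (mulfI (lt0r_neq0 bk)); rewrite mulr0 -dotZl gk_s_rec.
  rewrite -scaleNr dotDl dotZl os // dotC dot_mulmx dotC mul_gk_s dotDZr ow //.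
  have -> : dot (w k.+1) (w i) = 0.
    case: i ik => [|i] ik; first by rewrite gk_w0 dot0r.
    by rewrite ow ?gtn_eqF //; lia.
  by case: eqVneq => [->|_]; rewrite ?mulr1 ?mulr0; ring.
split=> //; apply: orthonormal_uptoS => //= [|i ik]; first exact: dot_gk_w.
apply: (mulfI (lt0r_neq0 ak)); rewrite mulr0 -dotZl gk_w_rec.
rewrite -scaleNr dotDl dotZl ow // -dot_mulmx mul_gk_w dotDZr.
rewrite !os' ?ltnS //; last by lia.
by rewrite eqSS gtn_eqF //; case: eqVneq => [->|_]; rewrite ?mulr1 ?mulr0; ring.
Qed.

(** The first step has no predecessor; as [0.-1] is [0], the Boolean factors
    below keep its coefficients zero. *)
Lemma gk_s_tridiag j : exists x y z,
  (A *m A^T) *m s j.+1 = x *: s j.-1.+1 + y *: s j.+1 + z *: s j.+2.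
Proof.
exists (be j.+1 * al j * (j != 0)%:R).
exists (al j.+1 ^+ 2 + be j.+1 ^+ 2 * (j != 0)%:R), (al j.+1 * be j.+2).
rewrite -mulmxA mul_gk_s mulmxDZr mul_gk_w; case: j => [|j].
  (* The vectors are generalized so that [mxE] does not unfold them. *)
  rewrite gk_w0 mulmx0 /=; move: (s 1) (s 2) => u v.
  by apply/colP => i; rewrite !mxE; ring.
rewrite mul_gk_w /=; move: (s j.+1) (s j.+2) (s j.+3) => u v x.
by apply/colP => i; rewrite !mxE; ring.
Qed.

Lemma gk_w_tridiag j : exists x y z,
  (A^T *m A) *m w j.+1 = x *: w j.-1.+1 + y *: w j.+1 + z *: w j.+2.
Proof.
exists (al j.+1 * be j.+1 * (j != 0)%:R).
exists (al j.+1 ^+ 2 + be j.+2 ^+ 2), (be j.+2 * al j.+2).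
rewrite -mulmxA mul_gk_w mulmxDZr !mul_gk_s.
case: j => [|j]; rewrite ?gk_w0 /=.
  by move: (w 1) (w 2) => u v; apply/colP => i; rewrite !mxE; ring.
move: (w j.+1) (w j.+2) (w j.+3) => u v x.
by apply/colP => i; rewrite !mxE; ring.
Qed.

End GK.

(** * Recurrences of the Lanczos polynomials *)

Section Lanczos.
Variables (R : realType) (m n k : nat).
Variables (A : 'M[R]_(m.+1, n.+1)) (b : 'cV[R]_m.+1).
Variables (phi psi : nat -> {poly R}).
Notation al := (gk_alpha A b).
Notation be := (gk_beta A b).
Notation s := (gk_s A b).
Notation w := (gk_w A b).
Hypothesis pos : forall l, (l <= k)%N -> 0 < al l.+1 /\ 0 < be l.+1.
Hypothesis hphi : forall l : nat, (l <= k)%N ->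
  (size (phi l) <= l.+1)%N /\ s l.+1 = horner_mx (A *m A^T) (phi l) *m b.
Hypothesis hpsi : forall l : nat, (l <= k)%N ->
  (size (psi l) <= l.+1)%N /\
  w l.+1 = horner_mx (A^T *m A) (psi l) *m (A^T *m b).

Lemma lanczos_s_eq0 (p : {poly R}) : (size p <= k.+1)%N ->
  horner_mx (A *m A^T) p *m b = 0 -> p = 0.
Proof.
have [os _] := gk_orthonormal pos.
apply: (krylov_annihilator_eq0 (a := be 1) (phi := phi) os).
- by move=> j _; apply: gk_s_tridiag.
- by rewrite gk_beta1.
- by move=> l /hphi[].
Qed.

Lemma lanczos_w_eq0 (p : {poly R}) : (size p <= k.+1)%N ->
  horner_mx (A^T *m A) p *m (A^T *m b) = 0 -> p = 0.
Proof.
have [_ ow] := gk_orthonormal pos.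
apply: (krylov_annihilator_eq0 (a := be 1 * al 1) (phi := psi) ow).
- by move=> j _; apply: gk_w_tridiag.
- by rewrite -scalerA gk_w_rec gk_w0 scaler0 subr0 scalemxAr gk_beta1.
- by move=> l /hpsi[].
Qed.

(** In this and the next three lemmas the difference of the two sides has
    degree at most [k] and, by the recurrence of the vectors, annihilates the
    starting vector. *)
Lemma lanczos_phi0 : be 1 *: phi 0 = 1.
Proof.
have [sp E] := hphi (leq0n k).
apply/eqP; rewrite -subr_eq0; apply/eqP/lanczos_s_eq0.
  rewrite (leq_trans (size_polyD _ _)) // geq_max size_polyN size_poly1 andbT.
  by rewrite (leq_trans (size_scale_leq _ _)) ?(leq_trans sp).
by rewrite rmorphB /= horner_mxZ rmorph1 mulmxBl -scalemxAl -E gk_beta1 mul1mx subrr.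
Qed.

Lemma lanczos_psi0 : al 1 *: psi 0 = phi 0.
Proof.
have [sp E] := hphi (leq0n k); have [sp' E'] := hpsi (leq0n k).
apply/eqP; rewrite -subr_eq0; apply/eqP/lanczos_w_eq0.
  rewrite (leq_trans (size_polyD _ _)) // geq_max size_polyN.
  by rewrite (leq_trans (size_scale_leq _ _)) ?(leq_trans sp') ?(leq_trans sp).
rewrite rmorphB /= horner_mxZ mulmxBl -scalemxAl -E' gk_w_rec gk_w0 scaler0 subr0.
by rewrite mulmxA -horner_mx_mulC -mulmxA -E subrr.
Qed.

Lemma lanczos_psiS l : (l < k)%N ->
  al l.+2 *: psi l.+1 = phi l.+1 - be l.+2 *: psi l.
Proof.
move=> lk; have [sp E] := hphi lk; have [sp' E'] := hpsi lk.
have [sp'' E''] := hpsi (ltnW lk).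
apply/eqP; rewrite -subr_eq0; apply/eqP/lanczos_w_eq0.
  rewrite (leq_trans (size_polyD _ _)) // geq_max size_polyN.
  rewrite (leq_trans (size_scale_leq _ _)) ?(leq_trans sp') //=.
  rewrite (leq_trans (size_polyD _ _)) // geq_max size_polyN (leq_trans sp) //=.
  by rewrite (leq_trans (size_scale_leq _ _)) ?(leq_trans sp'') // leqW // ltnW.
rewrite !rmorphB /= !horner_mxZ !mulmxBl -!scalemxAl -E' -E''.
by rewrite mulmxA -horner_mx_mulC -[A^T *m _ *m b]mulmxA -E gk_w_rec subrr.
Qed.

Lemma lanczos_phiS l : (l < k)%N ->
  be l.+2 *: phi l.+1 = psi l * 'X - al l.+1 *: phi l.
Proof.
move=> lk; have [sp E] := hphi lk; have [sp' E'] := hphi (ltnW lk).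
have [sp'' E''] := hpsi (ltnW lk).
apply/eqP; rewrite -subr_eq0; apply/eqP/lanczos_s_eq0.
  rewrite (leq_trans (size_polyD _ _)) // geq_max size_polyN.
  rewrite (leq_trans (size_scale_leq _ _)) ?(leq_trans sp) //=.
  rewrite (leq_trans (size_polyD _ _)) // geq_max size_polyN.
  rewrite (leq_trans (size_polyMleq _ _)) ?size_polyX ?addn2 ?ltnS ?(leq_trans sp'') //=.
  by rewrite (leq_trans (size_scale_leq _ _)) ?(leq_trans sp') // leqW // ltnW.
rewrite !rmorphB rmorphM /= horner_mx_X !horner_mxZ !mulmxBl -!scalemxAl -E -E'.
rewrite gk_s_rec E''.
by rewrite -!mulmxA [A *m (horner_mx _ _ *m _)]mulmxA horner_mx_mulC -!mulmxA subrr.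
Qed.

End Lanczos.

(** * Bidiagonal matrices *)

Section Bidiag.
Variable R : realType.

(** A rectangular format lets one definition cover both the square matrix
    [gk_L] and [gk_Lplus]; the diagonals are sequences so that entries can be computed with
    natural indices. *)
Definition bidiag (d e : nat -> R) N M : 'M[R]_(N, M) :=
  \matrix_(p < N, q < M)
    if p == q :> nat then d q else if p == q.+1 :> nat then e q else 0.

Lemma sum_ord_pick N (F : nat -> R) i :
  \sum_(q < N) (if i == q :> nat then F q else 0) = if (i < N)%N then F i else 0.
Proof.
rewrite -big_mkcond -[RHS](@big_ord1_eq R 0 +%R F i N).
by apply: eq_bigl => q; rewrite eq_sym.
Qed.

Lemma bidiag_col (d e z : nat -> R) N M :
  bidiag d e N M *m (\col_(q < M) z q) =
  \col_(p < N) ((if (p < M)%N then d p * z p else 0) +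
    (if (0 < p <= M)%N then e p.-1 * z p.-1 else 0)).
Proof.
apply/colP => p; rewrite !mxE.
rewrite -(sum_ord_pick M (fun i => d i * z i)).
have -> : (if (0 < p <= M)%N then e p.-1 * z p.-1 else 0) =
    \sum_(q < M) (if p == q.+1 :> nat then e q * z q else 0).
  case: (p : nat) => [|i]; first by rewrite big1.
  exact/esym/(sum_ord_pick M (fun j => e j * z j) i).
rewrite -big_split; apply: eq_bigr => q _; rewrite !mxE /=.
case: eqVneq => [->|_]; first by rewrite ltn_eqF // addr0.
by case: eqVneq => _; rewrite ?mul0r add0r.
Qed.

Lemma tr_bidiag_col (d e z : nat -> R) N M :
  (bidiag d e N M)^T *m (\col_(p < N) z p) =
  \col_(q < M) ((if (q < N)%N then d q * z q else 0) +
    (if (q.+1 < N)%N then e q * z q.+1 else 0)).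
Proof.
apply/colP => q; rewrite !mxE.
rewrite -(sum_ord_pick N (fun i => d q * z i)).
rewrite -(sum_ord_pick N (fun i => e q * z i)).
rewrite -big_split; apply: eq_bigr => p _; rewrite !mxE /= eq_sym [_ == q.+1]eq_sym.
case: eqVneq => [->|_]; first by rewrite gtn_eqF // addr0.
by case: eqVneq => _; rewrite ?mul0r add0r.
Qed.

Lemma bidiag_unitmx (d e : nat -> R) N :
  (forall i, (i < N)%N -> d i != 0) -> bidiag d e N N \in unitmx.
Proof.
move=> d0; rewrite unitmxE unitfE det_trig; last first.
  apply/is_trig_mxP => i j ij; rewrite mxE.
  by rewrite ltn_eqF // ltn_eqF // ltnW.
by apply/prodf_neq0 => i _; rewrite mxE eqxx d0.
Qed.

Lemma gk_LE m n (A : 'M[R]_(m, n)) b N :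
  gk_L A b N = bidiag (fun i => gk_alpha A b i.+1) (fun i => gk_beta A b i.+2) N N.
Proof.
apply/matrixP => p q; rewrite !mxE -val_eqE.
by case: eqVneq => // _; case: eqVneq => // ->.
Qed.

Lemma gk_LplusE m n (A : 'M[R]_(m, n)) b k :
  gk_Lplus A b k =
  bidiag (fun i => gk_alpha A b i.+1) (fun i => gk_beta A b i.+2) (k + 1) k.
Proof.
apply/matrixP => p q; case: (splitP p) => [i|i] pi.
  have -> : p = lshift 1 i by apply: val_inj.
  by rewrite col_mxEu gk_LE !mxE.
have -> : p = rshift k i by apply: val_inj.
rewrite col_mxEd !mxE ord1 /= addn0 [k == q]gtn_eqF // [k == _]eq_sym.
by case: eqVneq => [->|_]; rewrite ?mulr1 ?mulr0.
Qed.

(** * The LSMR problem in bidiagonal coordinates *)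

(** Here [d], [e] are the diagonals, [be] is the norm of the right-hand side, and
    [f], [p] are the sequences of values at 0 of the Lanczos polynomials [phi] and
    [psi]. *)
Section ReducedProblem.
Variables (k : nat) (d e f p : nat -> R) (be : R).
Hypothesis d_gt0 : forall i, (i <= k)%N -> 0 < d i.
Hypothesis e_gt0 : forall i, (i < k)%N -> 0 < e i.
Hypothesis f0E : be * f 0 = 1.
Hypothesis p0E : d 0 * p 0 = f 0.
Hypothesis pSE : forall l, (l < k)%N -> d l.+1 * p l.+1 = f l.+1 - e l * p l.
Hypothesis fSE : forall l, (l < k)%N -> e l * f l.+1 = - (d l * f l).

Local Notation L := (bidiag d e (k + 1) (k + 1)).
Local Notation Lp := (bidiag d e (k + 1) k).
Local Notation e1 := (unit_col R (k + 1) 1).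
Let q : 'cV[R]_(k + 1) := \col_i p i.
Let c := (\sum_(0 <= l < k.+1) p l ^+ 2)^-1.
Let t l := f l * \sum_(l <= j < k.+1) (d j)^-1 * (f j)^-1 * p j.
Let T : 'cV[R]_(k + 1) := \col_i t i.

Lemma f_neq0 l : (l <= k)%N -> f l != 0.
Proof.
elim: l => [_|l IHl lk].
  by apply: contra_eq_neq f0E => ->; rewrite mulr0 eq_sym oner_eq0.
have := fSE lk; apply: contra_eq_neq => ->.
by rewrite mulr0 eq_sym oppr_eq0 mulf_eq0 negb_or IHl ?(ltnW lk) // gt_eqF ?d_gt0 // ltnW.
Qed.

Lemma L_mul_q : L *m q = \col_i f i.
Proof.
rewrite bidiag_col; apply/colP => -[i ik]; rewrite !mxE /= ik.
case: i ik => [|i] ik /=; first by rewrite p0E addr0.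
by rewrite ltnW // pSE ?subrK //; lia.
Qed.

Lemma trLp_mul_f : Lp^T *m (\col_i f i) = 0.
Proof.
rewrite tr_bidiag_col; apply/colP => -[i ik]; rewrite !mxE /=.
by rewrite ifT ?ifT ?fSE ?addrN //; lia.
Qed.

(** Back substitution: by the recurrence of [f], the tail of the sum in [t l] is
    exactly what the superdiagonal of [L^T] contributes with the opposite
    sign, which leaves the term [p l]. *)
Lemma trL_mul_T : L^T *m T = q.
Proof.
rewrite tr_bidiag_col; apply/colP => -[i ik]; rewrite !mxE /= ik.
have ik' : (i <= k)%N by lia.
have fi := f_neq0 ik'; have di := lt0r_neq0 (d_gt0 ik').
have tE : d i * t i = p i + d i * f i * \sum_(i.+1 <= j < k.+1) (d j)^-1 * (f j)^-1 * p j.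
  by rewrite /t big_ltn //; field; rewrite fi.
case: ifP => ik1.
  by rewrite tE /t mulrA fSE; [ring | lia].
by rewrite tE (_ : i = k) ?big_geq //; [ring | lia].
Qed.

Lemma p_sq_gt0 : 0 < \sum_(0 <= l < k.+1) p l ^+ 2.
Proof.
rewrite big_nat_recl // ltr_wpDr ?sumr_ge0 // => [i _|]; first exact: sqr_ge0.
rewrite exprn_even_gt0 //=; apply: contra_eq_neq p0E => ->.
by rewrite mulr0 eq_sym f_neq0.
Qed.

Let r l := be * (l == 0%N)%:R - c * t l.

(** The scaling [c] of [T] is the one for which this sum vanishes, since
    [f . t = (L q) . T = q . (L^T T) = q . q]. *)
Lemma sum_f_r : \sum_(0 <= l < k.+1) f l * r l = 0.
Proof.
have dotft : \sum_(0 <= l < k.+1) f l * t l = c^-1.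
  rewrite /c invrK -addn1 !big_mkord.
  transitivity (dot (L *m q) T).
    by rewrite L_mul_q; apply: eq_bigr => i _; rewrite !mxE.
  rewrite dotC dot_mulmx trL_mul_T.
  by apply: eq_bigr => i _; rewrite !mxE expr2.
rewrite (eq_bigr (fun l => be * f l * (l == 0%N)%:R - c * (f l * t l))); last first.
  by move=> l _; rewrite /r; ring.
rewrite big_split /= sumrN -mulr_sumr dotft mulfV ?invr_neq0 ?gt_eqF ?p_sq_gt0 //.
rewrite big_nat_recl // big1 => [|i _]; last by rewrite mulr0.
by rewrite f0E eqxx mulr1 addr0 subrr.
Qed.

Let x l := (d l * f l)^-1 * \sum_(0 <= i < l.+1) f i * r i.

(** Forward substitution determines [x] from the first [k] rows; the last row
    is the solvability condition [sum_f_r], because [f] spans the kernel of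
    [Lp^T]. *)
Lemma Lp_mul_x : Lp *m (\col_i x i) = be *: e1 - c *: T.
Proof.
rewrite bidiag_col; apply/colP => -[i ik]; rewrite !mxE /=.
rewrite -[RHS]/(r i).
have ik' : (i <= k)%N by lia.
have ex l : (l < k)%N ->
    e l * x l = - (f l.+1)^-1 * \sum_(0 <= i < l.+1) f i * r i.
  move=> lk; rewrite /x -[d l * f l]opprK -fSE //.
  by field; rewrite ?oppr_eq0 f_neq0 // lt0r_neq0 ?e_gt0.
have dx l : (l <= k)%N -> d l * x l = (f l)^-1 * \sum_(0 <= i < l.+1) f i * r i.
  move=> lk; rewrite /x; field.
  by rewrite f_neq0 // lt0r_neq0 ?d_gt0.
have fi := f_neq0 ik'.
case: i ik ik' fi => [|i] ik ik' fi /=.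
  case: ifP => k0; last first.
    have := sum_f_r; rewrite (_ : k = 0)%N; last by lia.
    by rewrite big_nat1 => /eqP; rewrite mulf_eq0 (negPf fi) /= addr0 => /eqP.
  by rewrite dx // big_nat1 addr0 mulKf.
rewrite ik' ex //; case: ifP => ik1.
  by rewrite dx // big_nat_recr //=; field.
(* The last row, where only the subdiagonal entry is left. *)
have := sum_f_r; rewrite (_ : k = i.+1)%N; last by lia.
rewrite big_nat_recr //= => /eqP; rewrite addr_eq0 => /eqP ->.
by field.
Qed.

Lemma trL_mul_e1 : L^T *m e1 = d 0 *: e1.
Proof.
have -> : e1 = \col_i (i == 0%N :> nat)%:R by apply/colP => i; rewrite !mxE.
rewrite (tr_bidiag_col d e (fun i => (i == 0%N)%:R)).
apply/colP => -[i ik]; rewrite !mxE /= ik.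
by rewrite mulr0 if_same addr0; case: eqVneq => [->|_]; rewrite ?mulr0.
Qed.

(** Pythagoras: [q] is orthogonal to the range of [L^T *m Lp], so the objective
    at [y] exceeds that at the explicit [x] unless both vectors coincide. *)
Lemma argmin_reduced_residual (y : 'cV[R]_k) :
    is_argmin (fun z => enorm ((be * d 0) *: e1 - L^T *m Lp *m z)) y ->
  be *: e1 - Lp *m y = c *: T.
Proof.
pose g z := L^T *m (be *: e1 - Lp *m z).
have gE z : (be * d 0) *: e1 - L^T *m Lp *m z = g z.
  by rewrite /g mulmxBr -scalemxAr trL_mul_e1 scalerA mulmxA.
pose xv : 'cV[R]_k := \col_i x i.
have gx : g xv = c *: q.
  by rewrite /g Lp_mul_x opprB addrC subrK -scalemxAr trL_mul_T.
move=> ymin; pose D := L^T *m (Lp *m (xv - y)).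
have gy : g y = c *: q + D.
  by rewrite -gx /g /D -mulmxDr [Lp *m (_ - _)]mulmxBr addrA subrK.
have qD : dot q D = 0.
  by rewrite dot_mulmx trmxK L_mul_q dot_mulmx trLp_mul_f dotC dot0r.
have /= := ymin xv; rewrite !gE gx gy !enormE ler_sqrt ?dot_ge0 //.
rewrite dotDr !dotDl [dot D (c *: q)]dotC !dotZl qD mulr0 addr0 add0r gerDl => D0.
have D_eq0 : D = 0 by apply/dot_eq0/le_anti; rewrite D0 dot_ge0.
move: gy; rewrite D_eq0 addr0 -trL_mul_T scalemxAr.
apply: can_inj (mulKmx _) _ _.
rewrite unitmx_tr bidiag_unitmx // => i ik.
by rewrite gt_eqF ?d_gt0 //; lia.
Qed.

End ReducedProblem.
End Bidiag.

(** * The residual *)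

Theorem proposition3 (R : realType) (m n k : nat)
    (A : 'M[R]_(m.+1, n.+1)) (b : 'cV[R]_m.+1)
    (phi psi : nat -> {poly R}) (y : 'cV[R]_k)
    (hb : b != 0) (hk : (1 <= k)%N)
    (hsteps : forall l : nat, (1 <= l <= k)%N ->
       0 < gk_alpha A b l /\ 0 < gk_beta A b l.+1)
    (halpha : 0 < gk_alpha A b k.+1)
    (hphi : forall l : nat, (l <= k)%N ->
       (size (phi l) <= l.+1)%N /\
       gk_s A b l.+1 = horner_mx (A *m A^T) (phi l) *m b)
    (hpsi : forall l : nat, (l <= k)%N ->
       (size (psi l) <= l.+1)%N /\
       gk_w A b l.+1 = horner_mx (A^T *m A) (psi l) *m (A^T *m b))
    (hy : is_argmin (lsmr_objective A b (k := k)) y) :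
  lsmr_residual A b y =
    (\sum_(0 <= l < k.+1) (psi l).[0] ^+ 2)^-1 *:
    \sum_(0 <= l < k.+1)
      ((phi l).[0] *
       \sum_(l <= j < k.+1)
         (gk_alpha A b j.+1)^-1 * (phi j).[0]^-1 * (psi j).[0])
      *: gk_s A b l.+1.
Proof.
have pos l : (l <= k)%N -> 0 < gk_alpha A b l.+1 /\ 0 < gk_beta A b l.+1.
  move=> lk; split.
    move: lk; rewrite leq_eqVlt => /predU1P[->//|lk].
    by have [] := hsteps l.+1 lk.
  case: l lk => [_|l lk]; last by have [] := hsteps l.+1 lk.
  rewrite lt0r sqrtr_ge0 andbT.
  by apply: contra_neq hb => /enorm_eq0.
have phi0 := lanczos_phi0 pos hphi.
have psi0 := lanczos_psi0 pos hphi hpsi.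
have psiS := lanczos_psiS pos hphi hpsi.
have phiS := lanczos_phiS pos hphi hpsi.
pose S : 'M[R]_(m.+1, k + 1) := \matrix_(i, l) gk_s A b l.+1 i 0.
have S_col (z : nat -> R) :
    S *m (\col_l z l) = \sum_(0 <= l < k.+1) z l *: gk_s A b l.+1.
  rewrite -[k.+1]addn1 big_mkord; apply/colP => i; rewrite mxE summxE.
  by apply: eq_bigr => l _; rewrite !mxE mulrC.
have AW : A *m gk_W A b k = S *m gk_Lplus A b k.
  apply/matrixP => i j.
  pose j0 : 'I_(k + 1) := lshift 1 j.
  have j1P : (j.+1 < k + 1)%N by rewrite addn1 ltnS.
  pose j1 := Ordinal j1P.
  suff /colP/(_ i) : col j (A *m gk_W A b k) = col j (S *m gk_Lplus A b k).
    by rewrite !mxE.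
  rewrite !colE -!mulmxA -!colE.
  have -> : col j (gk_W A b k) = gk_w A b j.+1 by apply/colP => l; rewrite !mxE.
  have -> : col j (gk_Lplus A b k) =
      gk_alpha A b j.+1 *: delta_mx j0 0 + gk_beta A b j.+2 *: delta_mx j1 0.
    apply/colP => l; rewrite gk_LplusE !mxE -!val_eqE /= !andbT.
    case: eqVneq => [->|_]; first by rewrite ltn_eqF // mulr1 mulr0 addr0.
    by case: eqVneq => _; rewrite ?mulr1 mulr0 ?mulr0 add0r.
  rewrite mulmxDZr -!colE mul_gk_w.
  by congr (_ *: _ + _ *: _); apply/colP => l; rewrite !mxE.
have bE : b = S *m (gk_beta A b 1 *: unit_col R (k + 1) 1).
  have -> : unit_col R (k + 1) 1 = \col_l (l == 0%N :> nat)%:R.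
    by apply/colP => l; rewrite !mxE.
  rewrite -scalemxAr (S_col (fun l => (l == 0%N)%:R)) big_nat_recl //.
  rewrite big1 => [|l _]; last by rewrite scale0r.
  by rewrite addr0 scale1r gk_beta1.
rewrite /lsmr_residual mulmxA AW {1}bE -mulmxA -mulmxBr gk_LplusE.
rewrite (@argmin_reduced_residual R k
  (fun i => gk_alpha A b i.+1) (fun i => gk_beta A b i.+2)
  (fun l => (phi l).[0]) (fun l => (psi l).[0])).
- by rewrite -scalemxAr -S_col.
- by move=> i /pos[].
- by move=> i ik; have [] := pos i.+1 ik.
- by rewrite -hornerZ phi0 hornerC.
- by rewrite -hornerZ psi0.
- by move=> l lk; rewrite -!hornerZ psiS // hornerD hornerN hornerZ.
- move=> l lk; rewrite -!hornerZ phiS // hornerD hornerN hornerMX mulr0 add0r.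
  by rewrite hornerZ.
- move=> z; have := hy z.
  by rewrite /lsmr_objective gk_LE gk_LplusE.
Qed.
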